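(* Let $N\ge2$ be an integer and $x\in[0,1]\setminus\mathbb{Q}$. Then: (1) $\widehat\omega(x,N)$ is not $1$-balanced. (2) $\omega(x,N)$ is not $(2N-1)$-balanced.
   Context: Let $N\ge 1$ be an integer and define $T_N:[0,1]\to[0,1]$ by $T_N(x)=\frac{N}{x}-\lfloor\frac{N}{x}\rfloor$ for $x\ne0$ and $T_N(0)=0$. For $x\in[0,1]\setminus\mathbb{Q}$ the (greedy) NCF digits of $x$ are $d_n=\lfloor N/T_N^{n-1}(x)\rfloor\ge N$, $n\ge1$; one writes $x=[0;d_1,d_2,\ldots]_N$. A substitution on $\{0,1\}$ is given by images of the letters (nonempty words) and extends to finite and infinite words by concatenation. For $x=[0;d_1,d_2,\ldots]_N$ irrational let $\sigma_n(0)=0^{d_n}1^N$, $\sigma_n(1)=0$ and $\widehat\sigma_n(0)=0^{d_n}1$, $\widehat\sigma_n(1)=0^N$ for $n\ge1$. The NCF sequence $\omega(x,N)\in\{0,1\}^{\mathbb N}$ is the unique infinite word $\omega$ for which there exist $\omega^{(1)},\omega^{(2)},\ldots\in\{0,1\}^{\mathbb{N}}$ with $\omega^{(1)}=\omega$ and $\omega^{(n)}=\sigma_n(\omega^{(n+1)})$ for all $n\ge1$. The dual NCF sequence $\widehat\omega(x,N)$ is defined in the same way with $\widehat\sigma_n$ in place of $\sigma_n$. For a finite word $u$, $|u|$ is its length and $|u|_a$ the number of occurrences of the letter $a$ in $u$. A sequence $\nu\in\{0,1\}^{\mathbb{N}}$ is $C$-balanced ($C>0$) if for all finite factors (contiguous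 subwords) $u,v$ of $\nu$ with $|u|=|v|$ one has $-C\le|u|_a-|v|_a\le C$ for every letter $a$. *)

(* Defs.v *)
From mathcomp Require Import all_boot all_order all_algebra.
From mathcomp Require Import all_classical all_reals.

Set Implicit Arguments.
Unset Strict Implicit.
Unset Printing Implicit Defensive.

Import Order.TTheory GRing.Theory Num.Theory.
Local Open Scope classical_set_scope.
Local Open Scope ring_scope.

Definition ncf_map (R : realType) (N : nat) (x : R) : R :=
  if x == 0 then 0 else N%:R / x - (Num.floor (N%:R / x))%:~R.

(* Digits are indexed from n = 1, and the value at n = 0 is junk. The floor is
   nonnegative for x in [0, 1], so taking its absolute value only casts it
   to nat. *)
Definition ncf_digit (R : realType) (N : nat) (x : R) (n : nat) : nat :=
  `|Num.floor (N%:R / iter n.-1 (ncf_map N) x)|%N.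

(* The alphabet {0, 1} is bool, with false for 0 and true for 1. *)
Definition infinite_word := nat -> bool.
Definition substitution := bool -> seq bool.

Definition subst_word (s : substitution) (u : seq bool) : seq bool :=
  flatten (map s u).

(* When all the images of s are nonempty, s w_0 ... s w_n has length at least
   n + 1, so its n-th letter is the n-th letter of the infinite concatenation
   s w_0 s w_1 s w_2 ... *)
Definition subst_infinite_word (s : substitution) (w : infinite_word) :
    infinite_word :=
  fun n => nth false (subst_word s (mkseq w n.+1)) n.

Definition ncf_subst (N d : nat) : substitution := fun a =>
  if a then [:: false] else nseq d false ++ nseq N true.

Definition dual_ncf_subst (N d : nat) : substitution := fun a =>
  if a then nseq N false else rcons (nseq d false) true.

(* The directive sequence s is indexed from 1. *)
Definition generated_by (s : nat -> substitution) (w : infinite_word) : Prop :=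
  exists W : nat -> infinite_word, W 1%N = w /\
    forall n, (1 <= n)%N -> W n = subst_infinite_word (s n) (W n.+1).

(* Definite description: if no such word existed, or several did, this would be
   the constant word 000..., which is C-balanced for every C >= 0. *)
Definition the_generated_word (s : nat -> substitution) : infinite_word :=
  get [set w | unique (generated_by s) w].

Definition ncf_sequence (R : realType) (x : R) (N : nat) : infinite_word :=
  the_generated_word (fun n => ncf_subst N (ncf_digit N x n)).

Definition dual_ncf_sequence (R : realType) (x : R) (N : nat) : infinite_word :=
  the_generated_word (fun n => dual_ncf_subst N (ncf_digit N x n)).

Definition factor (u : seq bool) (w : infinite_word) : Prop :=
  exists i : nat, u = mkseq (fun k => w (i + k)%N) (size u).

Definition balanced (R : realType) (C : R) (w : infinite_word) : Prop :=
  forall u v : seq bool, factor u w -> factor v w -> size u = size v ->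
  forall a : bool,
    - C <= (count_mem a u)%:R - (count_mem a v)%:R <= C.

(* Main.v *)
(** Every image begins with 0 and |s_n(0)| >= 2, so the words s_1 ... s_k(0) form
    a strictly increasing chain of prefixes that determines the generated word.
    All digits are at least N >= 2, and explicit prefixes violate the balances.
    In the dual case, the second-level word contains 0010, so the word contains
    both 1 0^d_1 1 and 0^(N + d_1), hence 0^(d_1 + 2).
    In the other case, put B = 0^d_1 1^N. The second-level word contains
    1^N 0^d_2 1^N 0^(N + d_2), so the word contains 0^N B^d_2 0^N B and
    B^(N + d_2). The factors 0^N B^d_2 0^(N + d_1) and 1^N B^(d_2 + 1) have the
    same length, and their numbers of ones differ by 2N. *)

Require Import Defs.
From mathcomp Require Import all_boot all_order all_algebra.
From mathcomp Require Import all_classical all_reals.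
From mathcomp Require Import zify.

Set Implicit Arguments.
Unset Strict Implicit.
Unset Printing Implicit Defensive.

Import Order.TTheory GRing.Theory Num.Theory.
Local Open Scope nat_scope.

(** * Prefixes and factors of infinite words, and their images under substitutions *)

Definition begins (u : seq bool) (w : infinite_word) : Prop :=
  u = mkseq w (size u).

Definition nonerasing (s : substitution) : Prop := forall a, 0 < size (s a).

Lemma mkseq_addn (w : infinite_word) m n :
  mkseq w (m + n) = mkseq w m ++ mkseq (fun k => w (m + k)) n.
Proof. by rewrite /mkseq iotaD map_cat add0n -[X in iota X n]addn0 iotaDl -map_comp. Qed.

Lemma begins_nth u w i : begins u w -> i < size u -> w i = nth false u i.
Proof. by move=> -> iu; rewrite nth_mkseq // -(size_mkseq w (size u)). Qed.

Lemma nth_begins u w :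
  (forall i, i < size u -> w i = nth false u i) -> begins u w.
Proof.
move=> uw; apply: (@eq_from_nth _ false); first by rewrite size_mkseq.
by move=> i iu; rewrite nth_mkseq // uw.
Qed.

Lemma begins_catl u v w : begins (u ++ v) w -> begins u w.
Proof.
rewrite {1}/begins size_cat mkseq_addn => /eqP.
by rewrite eqseq_cat ?size_mkseq // => /andP[/eqP].
Qed.

Lemma begins_factor p u q w : begins (p ++ u ++ q) w -> Defs.factor u w.
Proof.
rewrite catA => /begins_catl; rewrite {1}/begins size_cat mkseq_addn => /eqP.
by rewrite eqseq_cat ?size_mkseq // => /andP[_ /eqP ?]; exists (size p).
Qed.

Lemma subst_word_cat s u v :
  subst_word s (u ++ v) = subst_word s u ++ subst_word s v.
Proof. by rewrite /subst_word map_cat flatten_cat. Qed.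

Lemma subst_word_nseq s n a : subst_word s (nseq n a) = flatten (nseq n (s a)).
Proof. by rewrite /subst_word map_nseq. Qed.

Lemma subst_word1 s a : subst_word s [:: a] = s a.
Proof. exact: cats0. Qed.

Lemma leq_size_subst_word s u : nonerasing s -> size u <= size (subst_word s u).
Proof.
move=> s_gt0; elim: u => //= a u IH.
by rewrite -cat1s subst_word_cat subst_word1 size_cat -add1n leq_add.
Qed.

Lemma begins_subst s u w : nonerasing s ->
  begins u w -> begins (subst_word s u) (subst_infinite_word s w).
Proof.
move=> s_gt0 uw; apply: nth_begins => i iu; rewrite /subst_infinite_word.
set p := mkseq w i.+1.
have ip : i < size (subst_word s p).
  by rewrite (leq_trans _ (leq_size_subst_word _ s_gt0)) // size_mkseq.
(* Both sides are the prefix of [w] of length [i.+1 + size u], so the images of [p] and of [u] are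
   prefixes of one word; both are longer than [i], hence agree there. *)
have /(congr1 (fun v => nth false (subst_word s v) i)) :
    p ++ mkseq (fun k => w (i.+1 + k)) (size u) =
    u ++ mkseq (fun k => w (size u + k)) i.+1.
  by rewrite {2}uw -!mkseq_addn addnC.
by rewrite !subst_word_cat !nth_cat ip iu.
Qed.

(** The default [true] of [head] also rules out empty images. *)
Definition zero_prolongable (s : nat -> substitution) : Prop :=
  forall n, 1 <= n -> (forall a, ~~ head true (s n a)) /\ 1 < size (s n false).

(** * Existence and uniqueness of the generated word *)

Section GeneratedWord.
Variable s : nat -> substitution.
Hypothesis s_prol : zero_prolongable s.

Lemma zero_prolongable_nonerasing n : 1 <= n -> nonerasing (s n).
Proof. by move=> /s_prol[+ _] a => /(_ a); case: (s n a). Qed.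

(** This is s_n s_(n+1) ... s_(n+k-1)(0). *)
Fixpoint zero_image (k n : nat) : seq bool :=
  if k is k'.+1 then subst_word (s n) (zero_image k' n.+1) else [:: false].

(** Since s_n(0) is 0 followed by a nonempty word, the case k = 0 holds; applying s_n to the
    extension at level n + 1 gives the induction step. *)
Lemma zero_image_extends k n : 1 <= n ->
  exists2 t, 0 < size t & zero_image k.+1 n = zero_image k n ++ t.
Proof.
elim: k n => [|k IH] n n_gt0.
  have [/(_ false) + +] := s_prol n_gt0.
  rewrite /= subst_word1; case: (s n false) => [|[] t] //= _ t_gt0.
  by exists t.
have [t t_gt0 eq_t] := IH n.+1 isT.
exists (subst_word (s n) t); last by rewrite -subst_word_cat -eq_t.
exact: leq_trans t_gt0 (leq_size_subst_word _ (zero_prolongable_nonerasing n_gt0)).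
Qed.

Lemma zero_image_prefix k j n : 1 <= n ->
  exists t, zero_image (k + j) n = zero_image k n ++ t.
Proof.
move=> n_gt0; elim: j => [|j [t eq_t]]; first by exists [::]; rewrite addn0 cats0.
have [t' _ eq_t'] := zero_image_extends (k + j) n_gt0.
by exists (t ++ t'); rewrite addnS eq_t' eq_t catA.
Qed.

Lemma ltn_size_zero_image k n : 1 <= n -> k < size (zero_image k n).
Proof.
move=> n_gt0; elim: k => // k IH.
have [t t_gt0 ->] := zero_image_extends k n_gt0.
by rewrite size_cat -addn1 leq_add.
Qed.

(** Any long enough [zero_image] would give the same letter; the i-th one has more than i letters,
    so the default of [nth] is never reached. *)
Definition limit_word n : infinite_word := fun i => nth false (zero_image i n) i.

Lemma begins_zero_image_limit_word k n : 1 <= n ->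
  begins (zero_image k n) (limit_word n).
Proof.
move=> n_gt0; apply: nth_begins => i ik; rewrite /limit_word.
have [t eq_t] := zero_image_prefix i k n_gt0.
have [t' eq_t'] := zero_image_prefix k i n_gt0.
have := congr1 (fun u => nth false u i) eq_t.
by rewrite addnC eq_t' !nth_cat ik ltn_size_zero_image.
Qed.

Lemma limit_word_subst n : 1 <= n ->
  limit_word n = subst_infinite_word (s n) (limit_word n.+1).
Proof.
move=> n_gt0; apply/funext => i.
have i_lt : i < size (zero_image i.+1 n) by exact/ltnW/ltn_size_zero_image.
rewrite (begins_nth (begins_zero_image_limit_word i.+1 n_gt0)) //.
(* By conversion, [zero_image i.+1 n] is the image under [s n] of [zero_image i n.+1]. *)
rewrite [RHS](begins_nth (u := zero_image i.+1 n)) //.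
apply: begins_subst; first exact: zero_prolongable_nonerasing.
exact: begins_zero_image_limit_word.
Qed.

(** This gives uniqueness: whatever the first letter of [W n.+1], its image starts with 0, so every
    [W n] starts with 0, and applying the substitutions propagates this prefix. *)
Lemma begins_zero_image k n (W : nat -> infinite_word) : 1 <= n ->
  (forall n, 1 <= n -> W n = subst_infinite_word (s n) (W n.+1)) ->
  begins (zero_image k n) (W n).
Proof.
move=> + W_subst; elim: k n => [|k IH] n n_gt0 /=; last first.
  rewrite W_subst //; apply: begins_subst; last exact: IH.
  exact: zero_prolongable_nonerasing.
rewrite /begins /mkseq /= W_subst // /subst_infinite_word /mkseq /= subst_word1.
by have [/(_ (W n.+1 0)) + _] := s_prol n_gt0; case: (s n _) => [|[]].
Qed.

Lemma generated_by_limit_word : generated_by s (limit_word 1).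
Proof. by exists limit_word; split=> // n; exact: limit_word_subst. Qed.

Lemma generated_by_unique w : generated_by s w -> limit_word 1 = w.
Proof.
move=> [W [<- W_subst]]; apply/funext => i.
rewrite (@begins_nth (zero_image i 1) (W 1)) ?ltn_size_zero_image //.
exact: begins_zero_image.
Qed.

Lemma begins_the_generated_word k :
  begins (zero_image k 1) (the_generated_word s).
Proof.
rewrite /the_generated_word (get_unique (x := limit_word 1)).
- exact: begins_zero_image_limit_word.
- by split; [exact: generated_by_limit_word | exact: generated_by_unique].
- by move=> w [/generated_by_unique ->].
Qed.

End GeneratedWord.

Local Open Scope ring_scope.

(** * Lower bound on the digits *)

Section Digits.
Variables (R : realType) (N : nat).
Hypothesis N_gt0 : (0 < N)%N.

Lemma irrational_ncf_map (x : R) : irrational x -> irrational (ncf_map N x).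
Proof.
move=> x_irr [q _ qE]; apply: x_irr.
move: qE; rewrite /ncf_map; case: eqP => [-> _|/eqP x_neq0 qE].
  by exists 0; rewrite ?rmorph0.
exists (N%:R / (q + (Num.floor (N%:R / x))%:~R)) => //.
rewrite fmorph_div rmorphD /= ratr_nat ratr_int qE subrK.
by rewrite invf_div mulrC divfK // pnatr_eq0 -lt0n.
Qed.

Lemma ncf_map_itv (x : R) : 0 <= ncf_map N x <= 1.
Proof.
rewrite /ncf_map; case: eqP => _; first by rewrite lexx ler01.
by rewrite subr_ge0 floor_le /= lerBlDl; apply/ltW; rewrite -intrD1 floorD1_gt.
Qed.

(** The iterates of x stay irrational and in [0, 1], hence are positive, and N / y >= N for 0 < y <=
    1. *)
Lemma leq_ncf_digit (x : R) n :
  0 <= x <= 1 -> irrational x -> (N <= ncf_digit N x n)%N.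
Proof.
move=> x01 x_irr; rewrite /ncf_digit.
have [] : 0 <= iter n.-1 (ncf_map N) x <= 1 /\ irrational (iter n.-1 (ncf_map N) x).
  elim: n.-1 => [//|k [_ ?]] /=; split; first exact: ncf_map_itv.
  exact: irrational_ncf_map.
move: (iter _ _ _) => y /andP[y_ge0 y_le1] y_irr.
have y_gt0 : 0 < y.
  rewrite lt_neqAle y_ge0 andbT; apply/eqP => y0.
  by apply: y_irr; exists 0; rewrite ?rmorph0.
have : (N%:Z <= Num.floor (N%:R / y)).
  rewrite floor_ge_int ler_pdivlMr // -[leRHS]mulr1.
  by rewrite ler_wpM2l // ler0n.
lia.
Qed.

End Digits.

Local Open Scope nat_scope.

(** * Explicit factors that violate the balances *)

Lemma zero_prolongable_ncf N (d : nat -> nat) :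
  0 < N -> (forall n, 0 < d n) -> zero_prolongable (fun n => ncf_subst N (d n)).
Proof.
move=> N_gt0 d_gt0 n _; have := d_gt0 n; case: (d n) => // e _.
by split=> [[]|] //=; rewrite size_cat !size_nseq; lia.
Qed.

Lemma zero_prolongable_dual_ncf N (d : nat -> nat) : 0 < N ->
  (forall n, 0 < d n) -> zero_prolongable (fun n => dual_ncf_subst N (d n)).
Proof.
move=> N_gt0 d_gt0 n _; have := d_gt0 n; case: (d n) => // e _.
split=> [[]|] //=; last by rewrite size_rcons.
by case: N N_gt0.
Qed.

Lemma dual_ncf_word_unbalanced (R : realType) N (d : nat -> nat) :
  2 <= N -> (forall n, 2 <= d n) ->
  ~ balanced (1 : R)%R (the_generated_word (fun n => dual_ncf_subst N (d n))).
Proof.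
move=> N_ge2 d_ge2; set s := fun n => _; set w := the_generated_word s.
have s_prol : zero_prolongable s.
  by apply: zero_prolongable_dual_ncf => [|n]; apply: ltnW.
have [t3 eq3] : exists t, zero_image s 1 3 = nseq 2 false ++ t.
  rewrite /= subst_word1 /s /= -(subnKC (d_ge2 3)) nseqD rcons_cat.
  by eexists.
(* The factor 0010 consists of the last three letters of one s_2(0) and the first letter of the
   next; [behead] removes that letter from the second copy. *)
have [p2 [t2 eq2]] : exists p t,
    zero_image s 2 2 = p ++ [:: false; false; true; false] ++ t.
  have -> : zero_image s 2 2 = subst_word (s 2) (zero_image s 1 3) by [].
  have s2E : s 2 false = nseq (d 2 - 2) false ++ [:: false; false; true].
    by rewrite /s /= -[in LHS](subnK (d_ge2 2)) nseqD rcons_cat.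
  rewrite eq3 subst_word_cat subst_word_nseq s2E /= cats0.
  exists (nseq (d 2 - 2) false), (behead (nseq (d 2 - 2) false ++
    [:: false; false; true]) ++ subst_word (s 2) t3).
  by rewrite -!catA /=; case: (d 2 - 2) => // n; rewrite /= -catA.
have eq1 : zero_image s 3 1 = subst_word (s 1) p2 ++ nseq (d 1) false ++
    (true :: rcons (nseq (d 1) false) true) ++
    nseq (N + d 1) false ++ true :: subst_word (s 1) t2.
  have -> : zero_image s 3 1 = subst_word (s 1) (zero_image s 2 2) by [].
  rewrite eq2 !subst_word_cat.
  by rewrite /subst_word /= cats0 nseqD -!cats1 -!catA.
have w_begins : begins (zero_image s 3 1) w by exact: begins_the_generated_word.
have u_factor : Defs.factor (true :: rcons (nseq (d 1) false) true) w.
  by move: w_begins; rewrite eq1 catA => /begins_factor.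
have v_factor : Defs.factor (nseq (d 1).+2 false) w.
  have N_d1 : N + d 1 = N - 2 + (d 1).+2 by lia.
  by move: w_begins; rewrite eq1 N_d1 nseqD -catA 3!catA => /begins_factor.
move=> /(_ _ _ u_factor v_factor); rewrite /= size_rcons size_nseq.
move=> /(_ erefl true) /andP[_].
rewrite -cats1 count_cat !count_nseq /= !mul0n /= subr0.
by rewrite (ler_nat R 2 1).
Qed.

Lemma ncf_word_unbalanced (R : realType) N (d : nat -> nat) :
  2 <= N -> (forall n, 2 <= d n) ->
  ~ balanced (2 * N%:R - 1 : R)%R
      (the_generated_word (fun n => ncf_subst N (d n))).
Proof.
move=> N_ge2 d_ge2; set s := fun n => _; set w := the_generated_word s.
have s_prol : zero_prolongable s.
  by apply: zero_prolongable_ncf => [|n]; apply: ltnW.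
(* The final 0 is the first letter of a second copy of s_3(0). *)
have [p3 [t3 eq3]] : exists p t, zero_image s 2 3 =
    p ++ nseq 2 false ++ nseq N true ++ [:: false] ++ t.
  have [t4 eq4] : exists t, zero_image s 1 4 = nseq 2 false ++ t.
    rewrite /= subst_word1 /s /= -(subnKC (d_ge2 4)) nseqD -catA.
    by eexists.
  have -> : zero_image s 2 3 = subst_word (s 3) (zero_image s 1 4) by [].
  have s3E : s 3 false = nseq (d 3 - 2) false ++ nseq 2 false ++ nseq N true.
    by rewrite /s /= -[in LHS](subnK (d_ge2 3)) nseqD -catA.
  rewrite eq4 subst_word_cat subst_word_nseq s3E /= cats0.
  exists (nseq (d 3 - 2) false), (behead (nseq (d 3 - 2) false ++
    nseq 2 false) ++ nseq N true ++ subst_word (s 3) t4).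
  by rewrite -!catA /=; case: (d 3 - 2) => // m; rewrite -!catA.
pose B := nseq (d 1) false ++ nseq N true.
have s2E u : subst_word (s 2) (nseq 2 false ++ nseq N true ++ [:: false] ++ u) =
    nseq (d 2) false ++ nseq N true ++ nseq (d 2) false ++ nseq N true ++
    nseq (N + d 2) false ++ nseq N true ++ subst_word (s 2) u.
  rewrite !subst_word_cat !subst_word_nseq subst_word1 /= cats0.
  have -> : flatten (nseq N [:: false]) = nseq N false by elim: (N) => //= n ->.
  by rewrite nseqD -!catA.
have s1_ones : subst_word (s 1) (nseq N true) = nseq N false.
  by rewrite subst_word_nseq /=; elim: (N) => //= n ->.
have s1_zeros n : subst_word (s 1) (nseq n false) = flatten (nseq n B).
  exact: subst_word_nseq.
have flattenD m n : flatten (nseq (m + n) B) = flatten (nseq m B) ++ flatten (nseq n B).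
  by rewrite nseqD flatten_cat.
have [p1 [t1 eq1]] : exists p t, zero_image s 4 1 = p ++
    (nseq N false ++ flatten (nseq (d 2) B) ++ nseq N false ++ nseq (d 1) false) ++
    (nseq N true ++ flatten (nseq (d 2 + 1) B)) ++ t.
  have -> : zero_image s 4 1 =
    subst_word (s 1) (subst_word (s 2) (zero_image s 2 3)) by [].
  rewrite eq3 subst_word_cat s2E !subst_word_cat !s1_ones !s1_zeros.
  (* The first [B] of B^(N + d_2) is cut between its zeros, which end the first factor, and its
     ones, which start the second; d_2 + 1 further copies complete the second, so the two factors
     are adjacent. *)
  have -> : N + d 2 = 1 + ((d 2 + 1) + (N - 2)) by lia.
  rewrite (flattenD 1) (flattenD (d 2 + 1)) [flatten (nseq 1 B)]cats0 {3}/B.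
  exists (subst_word (s 1) (subst_word (s 2) p3) ++ flatten (nseq (d 2) B)).
  by eexists; rewrite -!catA.
have w_begins : begins (zero_image s 4 1) w by exact: begins_the_generated_word.
rewrite eq1 in w_begins.
have u_factor := begins_factor w_begins.
move: w_begins; rewrite catA => /begins_factor v_factor.
have size_B n : size (flatten (nseq n B)) = n * (d 1 + N).
  by elim: n => //= n IH; rewrite size_cat IH size_cat !size_nseq mulSn.
have count_B n : count_mem true (flatten (nseq n B)) = n * N.
  elim: n => //= n IH.
  by rewrite count_cat IH count_cat !count_nseq /= mul0n mul1n mulSn.
have size_vu : size (nseq N true ++ flatten (nseq (d 2 + 1) B)) =
    size (nseq N false ++ flatten (nseq (d 2) B) ++ nseq N false ++ nseq (d 1) false).
  by rewrite !size_cat !size_B !size_nseq mulnDl; lia.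
move=> /(_ _ _ v_factor u_factor size_vu true) /andP[_].
rewrite !count_cat !count_B !count_nseq /= !mul0n mul1n !(addn0, add0n).
(* The other factor has d_2 N ones, so the difference is 2N, above the bound 2N - 1. *)
have -> : N + (d 2 + 1) * N = 2 * N + d 2 * N by rewrite mulnDl; lia.
rewrite natrD addrK natrM lerBrDl gerDr.
by rewrite ler10.
Qed.

Local Open Scope ring_scope.

Theorem proposition4p6 (R : realType) (N : nat) (x : R) (hN : (2 <= N)%N)
    (hx01 : 0 <= x <= 1) (hx : irrational x) :
  ~ balanced (1 : R) (dual_ncf_sequence x N) /\
  ~ balanced (2 * N%:R - 1 : R) (ncf_sequence x N).
Proof.
have d_ge2 n : (2 <= ncf_digit N x n)%N.
  by apply: (leq_trans hN); apply: leq_ncf_digit => //; exact: ltnW.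
split; first exact: dual_ncf_word_unbalanced.
exact: ncf_word_unbalanced.
Qed.
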